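(* If $X$ is a $k$-vector field on $\mathbb R^n$ with compact support and with coefficients in $\mathcal B_0^1$, then there exists a unique $k$-chain $\widetilde X\in\hat{\mathcal B}_k^1$ that represents $X$, i.e. such that $$\int_{\widetilde X}\omega=\int_{\mathbb R^n}\omega(X(p))\,dV\qquad\text{for all }\omega\in\mathcal B_k^1 .$$
   Context: Fix the standard inner product on $\mathbb R^n$, extended to $k$-vectors by $\langle u_1\wedge\dots\wedge u_k,v_1\wedge\dots\wedge v_k\rangle=\det(\langle u_i,v_j\rangle)$. A simple $k$-vector has mass $\|\alpha\|=\sqrt{\langle\alpha,\alpha\rangle}$; a general one has mass $\|\alpha\|=\inf\{\sum\|\alpha_j\|:\alpha=\sum\alpha_j,\ \alpha_j \text{ simple}\}$. $\mathcal A_k$ is the space of Dirac $k$-chains: finite formal sums $\sum(p_i;\alpha_i)$, $p_i\in\mathbb R^n$, $\alpha_i\in\Lambda_k(\mathbb R^n)$ (finitely supported functions $\mathbb R^n\to\Lambda_k(\mathbb R^n)$). With $\Delta_u(p;\alpha)=(p+u;\alpha)-(p;\alpha)$, the $B^1$ norm is $\|A\|_{B^1}=\inf\{\sum_i\|\alpha_i\|+\sum_j\|u_j\|\|\beta_j\|: A=\sum_i(p_i;\alpha_i)+\sum_j\Delta_{u_j}(q_j;\beta_j)\}$ (finite sums); $\hat{\mathcal B}_k^1$ is the completion of $\mathcal A_k$ in this norm. A $k$-form is a linear functional $\omega$ on $\mathcal A_k$; $\mathcal B_k^1$ is the space of $k$-forms with $\sup\{|\omega(p;\alpha)|:\|\alpha\|=1\}<\infty$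 and $\sup\{|\omega(\Delta_u(p;\alpha))|:\|u\|\|\alpha\|=1\}<\infty$ (bounded Lipschitz $k$-forms); in particular $\mathcal B_0^1$ is the space of bounded Lipschitz functions. For $J\in\hat{\mathcal B}_k^1$, $\omega\in\mathcal B_k^1$: $\int_J\omega=\lim\omega(A_i)$ for Dirac chains $A_i\to J$ in the $B^1$ norm. A $k$-vector field with coefficients in $\mathcal B_0^1$ is $X(p)=\sum_I(p;f_I(p)\alpha_I)$ with $f_I\in\mathcal B_0^1$ and $\{\alpha_I\}$ a basis of $\Lambda_k(\mathbb R^n)$; $\omega(X(p))=\sum_If_I(p)\,\omega(p;\alpha_I)$, and $dV$ is the volume element of $\mathbb R^n$. *)

(* Defs.v *)
(* R^n is 'rV[R]_n with R : realType; the library norm on 'rV[R]_n is the sup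
   norm, so the Euclidean norm is defined below as enorm. *)
From HB Require Import structures.
From mathcomp Require Import all_boot all_order all_fingroup all_algebra generic_quotient ring_quotient.
From mathcomp Require Import all_classical all_reals all_analysis.
From mathcomp Require Import ring lra.

Set Implicit Arguments.
Unset Strict Implicit.
Unset Printing Implicit Defensive.

Import Order.TTheory GRing.Theory Num.Theory.
Import numFieldNormedType.Exports.

Local Open Scope classical_set_scope.
Local Open Scope ring_scope.

Record seminorm (R : realType) (V : lmodType R) := Seminorm {
  seminorm_fun :> V -> R;
  seminormD : forall x y, seminorm_fun (x + y) <= seminorm_fun x + seminorm_fun y;
  seminormZ : forall (a : R) x, seminorm_fun (a *: x) = `|a| * seminorm_fun x
}.

Section seminorm_theory.
Variables (R : realType) (V : lmodType R) (N : seminorm V).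

Lemma seminorm0 : N 0 = 0.
Proof. by rewrite -(scale0r (0 : V)) seminormZ normr0 mul0r. Qed.

Lemma seminormN x : N (- x) = N x.
Proof. by rewrite -scaleN1r seminormZ normrN normr1 mul1r. Qed.

Lemma seminorm_ge0 x : 0 <= N x.
Proof.
have := seminormD N x (- x); rewrite subrr seminorm0 seminormN -mulr2n.
by rewrite pmulrn_lge0.
Qed.

Lemma seminormB x y : N (x - y) = N (y - x).
Proof. by rewrite -seminormN opprB. Qed.

Lemma seminorm_dist x y : `|N x - N y| <= N (x - y).
Proof.
rewrite ler_norml; apply/andP; split.
  rewrite lerNl opprB lerBlDr seminormB.
  by rewrite -[X in N X <= _](subrK x y) seminormD.
by rewrite lerBlDr -[X in N X <= _](subrK y x) seminormD.
Qed.

End seminorm_theory.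

(* Completion of a seminormed space: Cauchy sequences modulo null sequences. *)
Section completion.
Variables (R : realType) (V : lmodType R) (N : seminorm V).

Definition cauchy_seq (u : nat -> V) : Prop :=
  forall e : R, 0 < e -> exists M, forall i j,
    (M <= i)%N -> (M <= j)%N -> N (u i - u j) < e.

Definition null_seq (u : nat -> V) : Prop :=
  forall e : R, 0 < e -> exists M, forall i, (M <= i)%N -> N (u i) < e.

Lemma cauchy_seq_lin a u v :
  cauchy_seq u -> cauchy_seq v -> cauchy_seq (a *: u + v).
Proof.
move=> cu cv e e0.
have a0 : 0 < `|a| + 1 by rewrite ltr_wpDl.
have e2 : 0 < e / 2 by rewrite divr_gt0.
have [M1 H1] := cu _ (divr_gt0 e2 a0).
have [M2 H2] := cv _ e2.
exists (maxn M1 M2) => i j; rewrite !geq_max => /andP[i1 i2] /andP[j1 j2].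
have -> : (a *: u + v) i - (a *: u + v) j = a *: (u i - u j) + (v i - v j).
  by rewrite scalerBr opprD addrACA.
apply: (le_lt_trans (seminormD _ _ _)); rewrite seminormZ (splitr e).
apply: ler_ltD; last exact: H2.
apply: (@le_trans _ _ ((`|a| + 1) * N (u i - u j))).
  by rewrite ler_wpM2r ?seminorm_ge0// lerDl.
by rewrite mulrC -ler_pdivlMr// ltW// H1.
Qed.

Definition cauchy_pred : {pred nat -> V} := fun u => `[< cauchy_seq u >].

Lemma cauchy_pred_submod : submod_closed cauchy_pred.
Proof.
split.
  apply/asboolP => e e0; exists 0%N => i j _ _.
  by rewrite subrr seminorm0.
move=> a u v /asboolP cu /asboolP cv; apply/asboolP.
exact: cauchy_seq_lin.
Qed.

HB.instance Definition _ := GRing.isSubmodClosed.Build R (nat -> V) cauchy_pred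
  cauchy_pred_submod.

Record cauchy_sequence := CauchySequence {
  cauchy_val :> nat -> V; _ : cauchy_val \in cauchy_pred }.
HB.instance Definition _ := [isSub for cauchy_val].
HB.instance Definition _ := [Choice of cauchy_sequence by <:].
HB.instance Definition _ := [SubChoice_isSubLmodule of cauchy_sequence by <:].

Lemma cauchy_sequenceP (u : cauchy_sequence) : cauchy_seq u.
Proof. by case: u => u /= /asboolP. Qed.

Definition null_pred : {pred cauchy_sequence} := fun u => `[< null_seq u >].

Lemma null_pred_zmod : zmod_closed null_pred.
Proof.
split.
  by apply/asboolP => e e0; exists 0%N => i _; rewrite /= seminorm0.
move=> u v /asboolP nu /asboolP nv; apply/asboolP => e e0.
have e2 : 0 < e / 2 by rewrite divr_gt0.
have [M1 H1] := nu _ e2.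
have [M2 H2] := nv _ e2.
exists (maxn M1 M2) => i; rewrite !geq_max => /andP[i1 i2].
rewrite (splitr e); apply: (le_lt_trans (seminormD _ _ _)).
by rewrite seminormN ltrD ?H1 ?H2.
Qed.

HB.instance Definition _ := GRing.isZmodClosed.Build cauchy_sequence null_pred
  null_pred_zmod.

Definition completion : Type := Quotient.quot null_pred.
HB.instance Definition _ := GRing.Zmodule.on completion.
HB.instance Definition _ := EqQuotient.on completion.

Local Open Scope quotient_scope.
Local Notation pic := (\pi_(completion)).

Lemma pic_eq (u v : cauchy_sequence) : pic u = pic v <-> null_seq (u - v).
Proof.
have E : (pic u == pic v) = (u - v \in null_pred).
  by rewrite (Quotient.idealrBE null_pred u v).
split=> [/eqP|uv]; first by rewrite E => /asboolP.
by apply/eqP; rewrite E; apply/asboolP.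
Qed.

Lemma null_seqZ a (u : nat -> V) : null_seq u -> null_seq (a *: u).
Proof.
move=> nu e e0; have a0 : 0 < `|a| + 1 by rewrite ltr_wpDl.
have [M H] := nu _ (divr_gt0 e0 a0); exists M => i Mi.
rewrite seminormZ; apply: (@le_lt_trans _ _ ((`|a| + 1) * N (u i))).
  by rewrite ler_wpM2r ?seminorm_ge0// lerDl.
by rewrite mulrC -ltr_pdivlMr// H.
Qed.

Definition cscale (a : R) (x : completion) : completion := pic (a *: repr x).

Lemma pic_scale a u : cscale a (pic u) = pic (a *: u).
Proof.
apply/pic_eq; rewrite -scalerBr; apply: null_seqZ.
by apply/pic_eq; rewrite reprK.
Qed.

Lemma picD u v : pic (u + v) = pic u + pic v.
Proof. by rewrite -[LHS]/(\pi_(Quotient.quot null_pred) (u + v)) raddfD. Qed.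

Lemma picN u : pic (- u) = - pic u.
Proof. by rewrite -[LHS]/(\pi_(Quotient.quot null_pred) (- u)) raddfN. Qed.

Lemma pic_surj x : exists u, x = pic u.
Proof. by exists (repr x); rewrite reprK. Qed.

Lemma cscaleA a b x : cscale a (cscale b x) = cscale (a * b) x.
Proof. by have [u ->] := pic_surj x; rewrite !pic_scale scalerA. Qed.
Lemma cscale1 x : cscale 1 x = x.
Proof. by have [u ->] := pic_surj x; rewrite !pic_scale scale1r. Qed.
Lemma cscaleDr : right_distributive cscale +%R.
Proof.
move=> a x y; have [u ->] := pic_surj x; have [v ->] := pic_surj y.
by rewrite -picD !pic_scale -picD scalerDr.
Qed.
Lemma cscaleDl x : {morph cscale^~ x : a b / a + b}.
Proof. by move=> a b; have [u ->] := pic_surj x; rewrite !pic_scale -picD scalerDl. Qed.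

HB.instance Definition _ := GRing.Zmodule_isLmodule.Build R completion
  cscaleA cscale1 cscaleDr cscaleDl.

Lemma picZ a u : pic (a *: u) = a *: pic u.
Proof. by rewrite -pic_scale. Qed.

Lemma is_cvg_seminorm (u : cauchy_sequence) : cvgn (fun i => N (u i)).
Proof.
apply: cauchy_cvg; apply: cauchy_exP => e e0.
have [M H] := cauchy_sequenceP u e0.
exists (N (u M)); exists M => // i /= Mi.
by apply: le_lt_trans (seminorm_dist N _ _) _; exact: H.
Qed.

Definition cnorm (x : completion) : R := limn (fun i => N (repr x i)).

Lemma null_seq_cvg (u : nat -> V) : null_seq u <-> (N (u i) @[i --> \oo] --> (0:R)).
Proof.
split=> [nu|/cvgrPdist_lt nu e e0].
  apply/cvgrPdist_lt => e e0; have [M H] := nu e e0.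
  by exists M => // i /= Mi; rewrite sub0r normrN ger0_norm ?seminorm_ge0// H.
have [M _ H] := nu e e0; exists M => i Mi; have := H i Mi.
by rewrite /= sub0r normrN ger0_norm ?seminorm_ge0.
Qed.

Lemma cvg_cnorm (u : cauchy_sequence) : N (u i) @[i --> \oo] --> cnorm (pic u).
Proof.
rewrite /cnorm; set v := repr _.
have uv : null_seq (u - v) by apply/pic_eq; rewrite reprK.
have -> : (fun i => N (u i)) = (fun i => N (v i) + (N (u i) - N (v i))).
  by apply/funext => i; rewrite addrC subrK.
rewrite -[X in _ --> X]addr0; apply: cvgD; first exact: is_cvg_seminorm.
apply/cvgrPdist_lt => e e0; have [M H] := uv e e0.
exists M => // i /= Mi; rewrite sub0r normrN.
by apply: le_lt_trans (seminorm_dist N _ _) _; exact: H.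
Qed.

Arguments cvg_cnorm : clear implicits.

Lemma cnormE (u : cauchy_sequence) : cnorm (pic u) = limn (fun i => N (u i)).
Proof. by apply/esym/cvg_lim => //; exact: cvg_cnorm. Qed.

Lemma cnormD x y : cnorm (x + y) <= cnorm x + cnorm y.
Proof.
have [u ->] := pic_surj x; have [v ->] := pic_surj y; rewrite -picD.
have h1 := cvg_cnorm (u + v).
have h2 : N (u i) + N (v i) @[i --> \oo] --> cnorm (pic u) + cnorm (pic v).
  exact: cvgD (cvg_cnorm u) (cvg_cnorm v).
apply: (ler_cvg_to h1 h2).
by apply: nearW => i; exact: seminormD.
Qed.

Lemma cnormZ (a : R) x : cnorm (a *: x) = `|a| * cnorm x.
Proof.
have [u ->] := pic_surj x; rewrite -picZ cnormE; apply/cvg_lim => //.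
rewrite [X in X @ _](_ : _ = fun i => `|a| * N (u i)); last first.
  by apply/funext => i; exact: seminormZ.
by apply: cvgMr; exact: cvg_cnorm.
Qed.

Lemma cnorm0_eq0 x : cnorm x = 0 -> x = 0.
Proof.
have [u ->] := pic_surj x => u0.
have -> : (0 : completion) = pic 0.
  by rewrite -[in RHS](subrr (0 : cauchy_sequence)) picD picN subrr.
apply/pic_eq; rewrite subr0; apply/null_seq_cvg.
by rewrite -u0; exact: cvg_cnorm.
Qed.

HB.instance Definition _ := Lmodule_isNormed.Build R completion
  cnormD cnormZ cnorm0_eq0.

Lemma cst_cauchy (v : V) : (fun=> v) \in cauchy_pred.
Proof. by apply/asboolP => e e0; exists 0%N => *; rewrite subrr seminorm0. Qed.

Definition to_completion (v : V) : completion := pic (CauchySequence (cst_cauchy v)).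

Lemma to_completion_linear : linear to_completion.
Proof.
move=> a u v; rewrite /to_completion -picZ -picD; congr (pic _).
exact: val_inj.
Qed.
HB.instance Definition _ := GRing.isLinear.Build R V completion _ to_completion
  to_completion_linear.

Lemma norm_to_completion v : `|to_completion v| = N v.
Proof. rewrite -[LHS]/(cnorm _) cnormE; apply/cvg_lim => //=. exact: (cvg_cst (N v)). Qed.

Lemma to_completion_cvg (u : cauchy_sequence) :
  to_completion (u i) @[i --> \oo] --> pic u.
Proof.
apply/cvgrPdist_le => e e0; have [M H] := cauchy_sequenceP u e0.
exists M => // i /= Mi; rewrite /to_completion -picN -picD.
rewrite -[X in X <= _]/(cnorm _) cnormE.
apply: limr_le; first exact: is_cvg_seminorm.
by exists M => // j /= Mj; apply/ltW/H.
Qed.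

Lemma to_completion_dense (x : completion) :
  exists u : nat -> V, to_completion (u i) @[i --> \oo] --> x.
Proof. by have [u ->] := pic_surj x; exists u; exact: to_completion_cvg. Qed.

Lemma completion_complete (F : set_system completion) :
  ProperFilter F -> cauchy F -> cvg F.
Proof.
move=> FF Fc.
have pos (m : nat) : 0 < m.+1%:R^-1 :> R by rewrite invr_gt0.
have /choice [v Hv] : forall m : nat, exists v : V,
    F (ball (to_completion v) m.+1%:R^-1).
  move=> m; have p2 : 0 < m.+1%:R^-1 / 2 :> R by rewrite divr_gt0.
  have /cauchyP /(_ _ p2) [x Fx] := Fc.
  have [u /cvgrPdist_lt /(_ _ p2) [M _ H]] := to_completion_dense x.
  exists (u M); apply: filterS Fx => y xy.
  rewrite [m.+1%:R^-1]splitr; apply: ball_triangle xy.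
  by apply: ball_sym; exact: H M (leqnn M).
have vb i j : N (v i - v j) < i.+1%:R^-1 + j.+1%:R^-1.
  have [y [yi yj]] := filter_ex (filterI (Hv i) (Hv j)).
  rewrite -norm_to_completion linearB/=.
  exact: ball_triangle yi (ball_sym yj).
have vc : v \in cauchy_pred.
  apply/asboolP => e e0.
  have e2 : 0 < e / 2 by rewrite divr_gt0.
  have [M HM] : exists M : nat, forall i, (M <= i)%N -> i.+1%:R^-1 < e / 2.
    by have [M _ H] := near_infty_natSinv_lt (PosNum e2); exists M => i /H.
  exists M => i j Mi Mj; apply: lt_trans (vb i j) _.
  by rewrite (splitr e) ltrD ?HM.
apply/cvg_ex; exists (pic (CauchySequence vc)).
apply/cvgrPdist_lt => e e0; have e2 : 0 < e / 2 by rewrite divr_gt0.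
have /cvgrPdist_lt /(_ _ e2) [M1 _ H1] := @to_completion_cvg (CauchySequence vc).
have [M2 _ H2] := near_infty_natSinv_lt (PosNum e2).
pose M := maxn M1 M2.
apply: filterS (Hv M) => y vy; rewrite [e]splitr.
have h1 := H1 M (leq_maxl _ _).
have h2 : ball (to_completion (v M)) (e / 2) y.
  apply: le_ball vy; apply/ltW; exact: H2 M (leq_maxr _ _).
apply: le_lt_trans (ler_distD (to_completion (v M)) _ _) _.
exact: ltrD h1 h2.
Qed.

HB.instance Definition _ := Uniform_isComplete.Build completion completion_complete.
End completion.

Section inf_seminorm.
Variables (R : realType) (V : lmodType R) (S : V -> set R).
Hypothesis S_neq0 : forall x, S x !=set0.
Hypothesis S_ge0 : forall x r, S x r -> 0 <= r.
Hypothesis S_add : forall x y r s, S x r -> S y s -> S (x + y) (r + s).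
Hypothesis S_scale : forall (a : R) x r, S x r -> S (a *: x) (`|a| * r).

Let S_inf x : has_inf (S x).
Proof. by split => //; exists 0 => r; exact: S_ge0. Qed.

Lemma inf_seminormD x y : inf (S (x + y)) <= inf (S x) + inf (S y).
Proof.
rewrite -lerBlDr; apply: lb_le_inf => // r Sr.
rewrite lerBlDr -lerBlDl; apply: lb_le_inf => // s Ss.
rewrite lerBlDl; apply: ge_inf; first exact: (S_inf _).2.
exact: S_add.
Qed.

Let inf_scale_le (a : R) x : a != 0 -> inf (S (a *: x)) <= `|a| * inf (S x).
Proof.
move=> a0; have pa : 0 < `|a| by rewrite normr_gt0.
rewrite -ler_pdivrMl//; apply: lb_le_inf => // r Sr.
rewrite ler_pdivrMl//; apply: ge_inf; first exact: (S_inf _).2.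
exact: S_scale.
Qed.

Lemma inf_seminormZ (a : R) x : inf (S (a *: x)) = `|a| * inf (S x).
Proof.
have [->|a0] := eqVneq a 0.
  rewrite normr0 mul0r scale0r; apply/eqP; rewrite eq_le; apply/andP; split.
    apply: ge_inf; first exact: (S_inf _).2.
    have [r Sr] := S_neq0 0; rewrite -(scale0r (0 : V)).
    by have := S_scale 0 Sr; rewrite normr0 mul0r.
  by apply: lb_le_inf => // r; exact: S_ge0.
apply/eqP; rewrite eq_le inf_scale_le//=.
have pa : 0 < `|a| by rewrite normr_gt0.
rewrite -ler_pdivlMl// -normfV.
have := @inf_scale_le a^-1 (a *: x); rewrite scalerA mulVf// scale1r.
by apply; rewrite invr_eq0.
Qed.

Definition inf_seminorm : seminorm V := Seminorm inf_seminormD inf_seminormZ.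

End inf_seminorm.
Definition multi_index (n k : nat) : Type :=
  {t : k.-tuple 'I_n | sorted ltn (map val t)}.
HB.instance Definition _ n k := Finite.on (multi_index n k).

(* Lambda_k(R^n) in coordinates: a I is the coefficient of
   e_{I_0} /\ ... /\ e_{I_(k-1)}, for I a strictly increasing multi-index. *)
Definition kvector (R : realType) (n k : nat) : Type :=
  {ffun multi_index n k -> R^o}.
HB.instance Definition _ (R : realType) n k := Vector.on (kvector R n k).

Section mass.
Variables (R : realType) (n k : nat).
Implicit Types (u v : 'I_k -> 'rV[R]_n) (a b : kvector R n k).

Definition dotv (x y : 'rV[R]_n) : R := \sum_i x 0 i * y 0 i.
Definition enorm (x : 'rV[R]_n) : R := Num.sqrt (dotv x x).

(* The coordinates of u_0 /\ ... /\ u_(k-1) are the k x k minors. *)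
Definition wedge u : kvector R n k :=
  [ffun I : multi_index n k => \det (\matrix_(i, j) u i 0 (tnth (val I) j))].

(* This is the inner product with <u_1 /\ .. /\ u_k, v_1 /\ .. /\ v_k> =
   det (<u_i, v_j>): see dotk_wedge. *)
Definition dotk a b : R := \sum_I a I * b I.

Lemma multi_index_inj (I : multi_index n k) : injective (tnth (val I)).
Proof.
apply/tuple_uniqP.
have := valP I; rewrite ltn_sorted_uniq_leq => /andP[+ _].
by rewrite map_inj_uniq//; exact: val_inj.
Qed.

Definition mi_comp (p : multi_index n k * 'S_k) : {ffun 'I_k -> 'I_n} :=
  [ffun i => tnth (val p.1) (p.2 i)].

Lemma mi_comp_inj : injective mi_comp.
Proof.
move=> [I s] [J t] /ffunP E.
have IJ : I = J.
  apply/val_inj/val_inj/(inj_map val_inj).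
  apply: (irr_sorted_eq ltn_trans ltnn (valP I) (valP J)).
  move=> x; apply/mapP/mapP => -[y /tnthP[i ->] ->].
    exists (tnth (val I) i) => //; apply/tnthP.
    by exists (t ((s^-1)%g i)); have := E ((s^-1)%g i); rewrite !ffunE/= permKV.
  exists (tnth (val J) i) => //; apply/tnthP.
  by exists (s ((t^-1)%g i)); have := E ((t^-1)%g i); rewrite !ffunE/= permKV.
subst J; congr pair; apply/permP => i; apply: (@multi_index_inj I).
by have := E i; rewrite !ffunE.
Qed.

Lemma mi_comp_onto (f : {ffun 'I_k -> 'I_n}) :
  injective f -> exists p, f = mi_comp p.
Proof.
move=> fi.
pose s := sort (fun x y : 'I_n => x <= y)%N (codom f).
have ss : size s == k by rewrite size_sort size_codom card_ord.
have srt : sorted ltn (map val (Tuple ss)).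
  rewrite ltn_sorted_uniq_leq map_inj_uniq; last exact: val_inj.
  rewrite /= sort_uniq; apply/andP; split; first exact/injectiveP.
  by rewrite sorted_map; apply: sort_sorted => x y; exact: leq_total.
pose I : multi_index n k := exist _ (Tuple ss) srt.
have fI i : exists j, f i == tnth (val I) j.
  have : f i \in Tuple ss by rewrite /= mem_sort codom_f.
  by move=> /tnthP[j ->]; exists j.
pose g i := xchoose (fI i).
have gE i : f i = tnth (val I) (g i) by apply/eqP; exact: (xchooseP (fI i)).
have gi : injective g by move=> i j ij; apply: fi; rewrite !gE ij.
exists (I, perm gi); apply/ffunP => i.
by rewrite ffunE/= permE gE.
Qed.

Lemma dotk_wedge u v :
  dotk (wedge u) (wedge v) = \det (\matrix_(i, j) dotv (u i) (v j)).
Proof.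
pose D (f : 'I_k -> 'I_n) := \det (\matrix_(i, j) v j 0 (f i)).
have -> : \det (\matrix_(i, j) dotv (u i) (v j)) =
    \sum_(f : {ffun 'I_k -> 'I_n}) (\prod_i u i 0 (f i)) * D f.
  rewrite /determinant.
  under eq_bigr => s _.
    under eq_bigr => i _ do rewrite mxE.
    rewrite bigA_distr_bigA mulr_sumr.
    over.
  rewrite exchange_big; apply: eq_bigr => f _.
  rewrite /D /determinant mulr_sumr; apply: eq_bigr => s _.
  rewrite big_split/= mulrCA; congr (_ * (_ * _)).
  by apply: eq_bigr => i _; rewrite mxE.
rewrite (bigID (fun f => f \in [set mi_comp p | p in [set: multi_index n k * 'S_k]]%SET))/=.
rewrite [X in _ = _ + X]big1 ?addr0; last first.
  move=> f nf; have [fi|] := boolP (injectiveb f).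
    have [p fp] := mi_comp_onto (injectiveP _ fi).
    by move: nf; rewrite fp imset_f// inE.
  move=> /injectivePn[i [j ij fij]].
  rewrite /D (determinant_alternate ij) ?mulr0// => l.
  by rewrite !mxE fij.
rewrite big_imset/=; last by move=> x y _ _; exact: mi_comp_inj.
rewrite (eq_bigl xpredT); last by move=> p; rewrite inE.
rewrite -(pair_big xpredT xpredT (fun I s => (\prod_i u i 0 (mi_comp (I, s) i)) *
   D (mi_comp (I, s))))/=.
apply: eq_bigr => I _; rewrite !ffunE.
transitivity (\sum_(s : 'S_k) ((-1) ^+ s * \prod_i u i 0 (tnth (val I) (s i))) *
    \det (\matrix_(i, j) v i 0 (tnth (val I) j))).
  rewrite -mulr_suml; congr (_ * _); apply: eq_bigr => s _.
  by congr (_ * _); apply: eq_bigr => i _; rewrite mxE.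
apply: eq_bigr => s _.
have -> : D (mi_comp (I, s)) =
    (-1) ^+ s * \det (\matrix_(i, j) v i 0 (tnth (val I) j)).
  rewrite -[in RHS]det_tr -det_perm -det_mulmx -row_permE /D; congr (\det _).
  by apply/matrixP => i j; rewrite !mxE ffunE.
rewrite mulrCA mulrA; congr (_ * _ * _).
by apply: eq_bigr => i _; rewrite ffunE.
Qed.

(* The scalar c only matters for k = 0, where the empty wedge is 1 but every
   0-vector is simple. *)
Definition simple a : Prop := exists (c : R) u, a = c *: wedge u.

Definition knorm a : R := Num.sqrt (dotk a a).

Definition simple_decomposition a (s : seq (kvector R n k)) : Prop :=
  (forall b, b \in s -> simple b) /\ a = \sum_(b <- s) b.

(* On simple k-vectors this infimum is knorm, see mass_simple. *)
Definition mass a : R :=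
  inf [set m | exists2 s, simple_decomposition a s & m = \sum_(b <- s) knorm b].

Lemma simpleZ (c : R) a : simple a -> simple (c *: a).
Proof. by move=> [d [u ->]]; exists (c * d), u; rewrite scalerA. Qed.

Lemma dotkZ (c : R) a b : dotk (c *: a) b = c * dotk a b.
Proof.
by rewrite /dotk mulr_sumr; apply: eq_bigr => I _; rewrite !ffunE mulrA.
Qed.

Lemma dotkC a b : dotk a b = dotk b a.
Proof. by apply: eq_bigr => I _; rewrite mulrC. Qed.

Lemma dotkDl a b c : dotk (a + b) c = dotk a c + dotk b c.
Proof. by rewrite -big_split; apply: eq_bigr => I _; rewrite !ffunE mulrDl. Qed.

Lemma dotk_ge0 a : 0 <= dotk a a.
Proof. by apply: sumr_ge0 => I _; rewrite -expr2 sqr_ge0. Qed.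

Lemma knormZ (c : R) a : knorm (c *: a) = `|c| * knorm a.
Proof.
by rewrite /knorm dotkZ dotkC dotkZ mulrA -expr2 sqrtrM ?sqr_ge0// sqrtr_sqr.
Qed.

Lemma knorm_ge0 a : 0 <= knorm a. Proof. exact: sqrtr_ge0. Qed.

Lemma knorm_sqr a : knorm a ^+ 2 = dotk a a.
Proof. by rewrite sqr_sqrtr// dotk_ge0. Qed.

Lemma dotk_le a b : dotk a b <= knorm a * knorm b.
Proof.
have [a0|a0] := eqVneq (knorm a) 0.
  have aI (I : multi_index n k) : a I = 0.
    have /eqP : dotk a a = 0 by rewrite -knorm_sqr a0 expr0n.
    rewrite psumr_eq0 => [|J _]; last by rewrite -expr2 sqr_ge0.
    move=> /allP /(_ I (mem_index_enum _))/=.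
    by rewrite mulf_eq0 orbb => /eqP.
  by rewrite a0 mul0r /dotk big1// => I _; rewrite aI mul0r.
have pa : 0 < knorm a by rewrite lt_def a0 knorm_ge0.
have := dotk_ge0 ((dotk a b) *: a + (- knorm a ^+ 2) *: b).
rewrite dotkDl !(dotkC _ (_ + _)) !dotkDl !dotkZ !(dotkC _ (_ *: _)) !dotkZ.
rewrite (dotkC b a) -!knorm_sqr.
move: (dotk a b) (knorm a) (knorm b) pa (knorm_ge0 b) => d x y x0 y0 H.
have {H} : 0 <= x ^+ 2 * ((x * y) ^+ 2 - d ^+ 2) by nra.
rewrite pmulr_rge0 ?exprn_gt0// subr_ge0 => H.
have [d0|d0] := leP d 0; first by rewrite (le_trans d0)// mulr_ge0// ltW.
by move: H; rewrite ler_pXn2r// nnegrE ?mulr_ge0// ltW.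
Qed.

Lemma knormD a b : knorm (a + b) <= knorm a + knorm b.
Proof.
rewrite -(@ler_pXn2r _ 2)// ?nnegrE ?addr_ge0 ?knorm_ge0//.
rewrite knorm_sqr dotkDl !(dotkC _ (_ + _)) !dotkDl (dotkC b a) sqrrD -!knorm_sqr.
have := dotk_le a b; lra.
Qed.

Lemma knorm_eq0 a : knorm a = 0 -> a = 0.
Proof.
move=> a0; apply/ffunP => I; rewrite ffunE.
have /eqP : dotk a a = 0 by rewrite -knorm_sqr a0 expr0n.
rewrite psumr_eq0 => [|J _]; last by rewrite -expr2 sqr_ge0.
move=> /allP /(_ I (mem_index_enum _))/=.
by rewrite mulf_eq0 orbb => /eqP.
Qed.

Definition mi_vect (I : multi_index n k) : 'I_k -> 'rV[R]_n :=
  fun j => delta_mx 0 (tnth (val I) j).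

Lemma wedge_mi_vect I : wedge (mi_vect I) = [ffun J => (J == I)%:R].
Proof.
apply/ffunP => J; rewrite !ffunE.
have [->|JI] := eqVneq.
  rewrite -[RHS](det1 R k); congr (\det _); apply/matrixP => i j.
  rewrite !mxE eqxx/= (inj_eq (@multi_index_inj I)).
  by rewrite eq_sym.
have [i Hi] : exists i, forall j, tnth (val I) i != tnth (val J) j.
  apply: contrapT => /forallNP H; move/eqP: JI; apply.
  have {}H i : exists j, tnth (val I) i == tnth (val J) j.
    have /existsNP[j /negP/negPn Hj] := H i; by exists j.
  pose g i := xchoose (H i).
  have gE i : tnth (val I) i = tnth (val J) (g i).
    by apply/eqP; exact: (xchooseP (H i)).
  have gi : injective g.
    by move=> i j ij; apply: (@multi_index_inj I); rewrite !gE ij.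
  have : mi_comp (I, 1%g) = mi_comp (J, perm gi).
    by apply/ffunP => i; rewrite !ffunE/= perm1 permE gE.
  by move=> /mi_comp_inj [->].
rewrite (expand_det_row _ i) big1// => j _; rewrite mxE.
by rewrite mxE eqxx/= eq_sym (negbTE (Hi j)) mul0r.
Qed.

Lemma simple_decomposition_exists a : exists s, simple_decomposition a s.
Proof.
exists [seq (a L *: wedge (mi_vect L) : kvector R n k) | L <- index_enum (multi_index n k)]; split.
  by move=> b /mapP[L _ ->]; exists (a L), (mi_vect L).
rewrite big_map; apply/ffunP => J; rewrite sum_ffunE (bigD1 J)//= big1 ?addr0.
  by rewrite wedge_mi_vect !ffunE eqxx -[LHS]mulr1.
move=> I IJ; rewrite wedge_mi_vect !ffunE eq_sym (negbTE IJ).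
exact: mulr0.
Qed.

Let mass_set a :=
  [set m | exists2 s, simple_decomposition a s & m = \sum_(b <- s) knorm b].

Let mass_set_neq0 a : mass_set a !=set0.
Proof.
have [s sa] := simple_decomposition_exists a.
by exists (\sum_(b <- s) knorm b), s.
Qed.

Let mass_set_ge0 a r : mass_set a r -> 0 <= r.
Proof. by move=> [s _ ->]; apply: sumr_ge0 => b _; exact: knorm_ge0. Qed.

Let mass_set_add a b r t : mass_set a r -> mass_set b t -> mass_set (a + b) (r + t).
Proof.
move=> [s1 [h1 ->] ->] [s2 [h2 ->] ->]; exists (s1 ++ s2); last by rewrite big_cat.
split; last by rewrite big_cat.
by move=> c; rewrite mem_cat => /orP[/h1|/h2].
Qed.

Let mass_set_scale (c : R) a r : mass_set a r -> mass_set (c *: a) (`|c| * r).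
Proof.
move=> [s [h ->] ->]; exists [seq c *: b | b <- s].
  split; last by rewrite big_map scaler_sumr.
  by move=> _ /mapP[b /h /simpleZ sb ->].
by rewrite big_map mulr_sumr; apply: eq_bigr => b _; rewrite knormZ.
Qed.

Definition mass_seminorm : seminorm (kvector R n k) :=
  inf_seminorm mass_set_neq0 mass_set_ge0 mass_set_add mass_set_scale.

Lemma massE a : mass a = mass_seminorm a. Proof. by []. Qed.

Lemma knorm_le_mass a : knorm a <= mass a.
Proof.
apply: lb_le_inf; first exact: mass_set_neq0.
move=> _ [s [_ ->] ->]; elim/big_ind2 : _ => //.
- by rewrite /knorm /dotk big1 ?sqrtr0// => I _; rewrite ffunE mul0r.
- by move=> x r y t xr yt; apply: le_trans (knormD _ _) _; exact: lerD.
Qed.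

Lemma mass_simple a : simple a -> mass a = knorm a.
Proof.
move=> sa; apply/eqP; rewrite eq_le knorm_le_mass andbT.
apply: ge_inf; first by exists 0 => r; exact: mass_set_ge0.
exists [:: a]; last by rewrite big_seq1.
by split; [move=> b; rewrite inE => /eqP ->|rewrite big_seq1].
Qed.

Lemma mass_eq0 a : mass a = 0 -> a = 0.
Proof.
move=> a0; apply: knorm_eq0; apply/eqP; rewrite eq_le knorm_ge0 andbT.
by rewrite -a0 knorm_le_mass.
Qed.

End mass.

Section dirac_chain.
Variables (R : realType) (n k : nat).
Local Notation E := ('rV[R]_n).

Definition finite_support_pred : {pred E -> kvector R n k} :=
  fun A => `[< finite_set [set p | A p != 0] >].

Lemma finite_support_submod : submod_closed finite_support_pred.
Proof.
split.
  by apply/asboolP; rewrite (_ : mkset _ = set0)// -subset0 => p /= /eqP.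
move=> c A B /asboolP fA /asboolP fB; apply/asboolP.
have : finite_set ([set p | A p != 0] `|` [set p | B p != 0]) by rewrite finite_setU.
apply: sub_finite_set => p /= H; have [Ap|] := eqVneq (A p) 0; last by left.
right; apply: contraNneq H => Bp.
by rewrite -[_ p]/(c *: A p + B p) Ap Bp scaler0 addr0.
Qed.

HB.instance Definition _ := GRing.isSubmodClosed.Build R (E -> kvector R n k)
  finite_support_pred finite_support_submod.

(* Finitely supported functions R^n -> Lambda_k(R^n); (p; a) is dirac_elem p a. *)
Record dirac_chain := DiracChain {
  dirac_chain_val :> E -> kvector R n k;
  _ : dirac_chain_val \in finite_support_pred }.
HB.instance Definition _ := [isSub for dirac_chain_val].
HB.instance Definition _ := [Choice of dirac_chain by <:].
HB.instance Definition _ := [SubChoice_isSubLmodule of dirac_chain by <:].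

Lemma dirac_finite_support (p : E) (a : kvector R n k) :
  (fun q => if q == p then a else 0) \in finite_support_pred.
Proof.
apply/asboolP; apply: sub_finite_set (finite_set1 p) => q /=.
by have [->//|_] := eqVneq q p; rewrite /= eqxx.
Qed.

Definition dirac_elem p a : dirac_chain := DiracChain (dirac_finite_support p a).

Definition dirac_diff (u p : E) (a : kvector R n k) : dirac_chain :=
  dirac_elem (p + u) a - dirac_elem p a.

Lemma dirac_linear p : linear (dirac_elem p).
Proof.
move=> c a b; apply/val_inj/funext => q.
rewrite -[RHS]/(c *: dirac_elem p a q + dirac_elem p b q)/=.
by case: ifP => // _; rewrite scaler0 addr0.
Qed.
HB.instance Definition _ p := GRing.isLinear.Build R _ _ _ (dirac_elem p) (dirac_linear p).

Lemma diracZ p c a : dirac_elem p (c *: a) = c *: dirac_elem p a.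
Proof. exact: linearZ. Qed.

Lemma dirac_chainD (A B : dirac_chain) p : (A + B) p = A p + B p.
Proof. by []. Qed.
Lemma dirac_chainZ c (A : dirac_chain) p : (c *: A) p = c *: A p.
Proof. by []. Qed.
Lemma dirac_chain_sum (I : Type) (r : seq I) (F : I -> dirac_chain) p :
  (\sum_(i <- r) F i) p = \sum_(i <- r) F i p.
Proof. by elim/big_rec2: _ => // i y z _ <-. Qed.

Lemma dirac_chain_decomp (A : dirac_chain) (r : seq E) :
  uniq r -> (forall p, A p != 0 -> p \in r) -> A = \sum_(p <- r) dirac_elem p (A p).
Proof.
move=> ur H; apply/val_inj/funext => q; rewrite -[LHS]/(A q).
rewrite -[RHS]/((\sum_(p <- r) dirac_elem p (A p)) q) dirac_chain_sum.
have [qr|qr] := boolP (q \in r).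
  rewrite (bigD1_seq q)//= eqxx big1 ?addr0// => p pq.
  by rewrite eq_sym (negbTE pq).
have -> : A q = 0 by apply/eqP; apply: contraNT qr => /H.
rewrite big1_seq// => p /= pr; case: eqVneq => // qp.
by move: qr; rewrite qp pr.
Qed.

Lemma dirac_chain_supp (A : dirac_chain) :
  exists r : seq E, uniq r /\ forall p, A p != 0 -> p \in r.
Proof.
have /asboolP/finite_seqP[r Hr] : dirac_chain_val A \in finite_support_pred.
  by case: A.
exists (undup r); split; first exact: undup_uniq.
by move=> p Ap; rewrite mem_undup; have : [set` r] p by rewrite -Hr.
Qed.

(* An entry ((u, q), b) of t stands for Delta_u (q; b). *)
Definition B1_decomposition (A : dirac_chain)
    (s : seq (E * kvector R n k)) (t : seq (E * E * kvector R n k)) : Prop :=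
  A = \sum_(x <- s) dirac_elem x.1 x.2 + \sum_(y <- t) dirac_diff y.1.1 y.1.2 y.2.

Definition B1_weight (s : seq (E * kvector R n k))
    (t : seq (E * E * kvector R n k)) : R :=
  \sum_(x <- s) mass x.2 + \sum_(y <- t) enorm y.1.1 * mass y.2.

Definition B1_norm (A : dirac_chain) : R :=
  inf [set m | exists s, exists2 t, B1_decomposition A s t & m = B1_weight s t].

Let B1_set A :=
  [set m | exists s, exists2 t, B1_decomposition A s t & m = B1_weight s t].

Lemma mass_ge0 (a : kvector R n k) : 0 <= mass a.
Proof. exact: (seminorm_ge0 (mass_seminorm R n k)). Qed.

Lemma enorm_ge0 (x : E) : 0 <= enorm x.
Proof. exact: sqrtr_ge0. Qed.

Lemma dirac_diffZ c u p a : dirac_diff u p (c *: a) = c *: dirac_diff u p a.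
Proof. by rewrite /dirac_diff !diracZ scalerBr. Qed.

Let B1_set_neq0 A : B1_set A !=set0.
Proof.
have [r [ur Hr]] := dirac_chain_supp A.
exists (B1_weight [seq (p, A p) | p <- r] [::]), [seq (p, A p) | p <- r], [::] => //.
by rewrite /B1_decomposition big_nil addr0 big_map/=; exact: dirac_chain_decomp.
Qed.

Let B1_set_ge0 A r : B1_set A r -> 0 <= r.
Proof.
move=> [s [t _ ->]]; apply: addr_ge0; apply: sumr_ge0 => x _.
  exact: mass_ge0.
by rewrite mulr_ge0 ?mass_ge0 ?enorm_ge0.
Qed.

Let B1_set_add A B r t : B1_set A r -> B1_set B t -> B1_set (A + B) (r + t).
Proof.
move=> [s1 [t1 -> ->]] [s2 [t2 -> ->]]; exists (s1 ++ s2), (t1 ++ t2).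
  by rewrite /B1_decomposition !big_cat/= addrACA.
by rewrite /B1_weight !big_cat/= addrACA.
Qed.

Let B1_set_scale (c : R) A r : B1_set A r -> B1_set (c *: A) (`|c| * r).
Proof.
move=> [s [t -> ->]].
exists [seq (x.1, c *: x.2) | x <- s], [seq (y.1, c *: y.2) | y <- t].
  rewrite /B1_decomposition !big_map scalerDr !scaler_sumr.
  congr (_ + _); apply: eq_bigr => x _ /=; first by rewrite diracZ.
  by rewrite dirac_diffZ.
rewrite /B1_weight !big_map mulrDr !mulr_sumr.
congr (_ + _); apply: eq_bigr => x _ /=; rewrite !massE seminormZ//.
by rewrite mulrCA.
Qed.

Definition B1_seminorm : seminorm dirac_chain :=
  inf_seminorm B1_set_neq0 B1_set_ge0 B1_set_add B1_set_scale.

Lemma B1_seminormE A : B1_seminorm A = B1_norm A. Proof. by []. Qed.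

Definition Bhat : Type := completion B1_seminorm.
HB.instance Definition _ := CompleteNormedModule.on Bhat.

Definition to_Bhat : dirac_chain -> Bhat := @to_completion R dirac_chain B1_seminorm.
HB.instance Definition _ := GRing.Linear.on to_Bhat.

Definition kform := {scalar dirac_chain}.

Definition B1_form (w : kform) : Prop :=
  has_ubound [set r | exists p a, mass a = 1 /\ r = `|w (dirac_elem p a)|] /\
  has_ubound [set r | exists u p a,
    enorm u * mass a = 1 /\ r = `|w (dirac_diff u p a)|].

(* The limit of w (A i) along any sequence of Dirac chains A i converging to J;
   it exists and is independent of the sequence for w in B^1, see
   cvg_chain_integral. *)
Definition chain_integral (J : Bhat) (w : kform) : R :=
  get [set l | forall A : nat -> dirac_chain,
    to_Bhat (A i) @[i --> \oo] --> J -> w (A i) @[i --> \oo] --> l].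

Lemma B1_form_bounded (w : kform) : B1_form w ->
  exists C, forall A, `|w A| <= C * B1_norm A.
Proof.
move=> [[C1 H1] [C2 H2]].
pose C := Num.max 0 (Num.max C1 C2).
have C0 : 0 <= C by rewrite /C le_max lexx.
have CC1 : C1 <= C by rewrite /C !le_max lexx orbT.
have CC2 : C2 <= C by rewrite /C !le_max lexx !orbT.
have massV (a : kvector R n k) : a != 0 -> 0 < mass a.
  move=> a0; rewrite lt_def mass_ge0 andbT; apply: contraNneq a0.
  by move/mass_eq0 ->.
have b1 p a : `|w (dirac_elem p a)| <= C * mass a.
  have [->|/massV a0] := eqVneq a 0.
    by rewrite !linear0 normr0; apply: mulr_ge0 => //; exact: mass_ge0.
  have /H1 : [set r | exists p a, mass a = 1 /\ r = `|w (dirac_elem p a)|]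
      `|w (dirac_elem p ((mass a)^-1 *: a))|.
    exists p, ((mass a)^-1 *: a); split => //.
    by rewrite massE seminormZ -massE normfV ger0_norm ?mass_ge0// mulVf// gt_eqF.
  rewrite diracZ linearZ/= normrM normfV (ger0_norm (mass_ge0 a)) => H.
  by move: (le_trans H CC1); rewrite ler_pdivrMl// mulrC.
have b2 u p a : `|w (dirac_diff u p a)| <= C * (enorm u * mass a).
  have me0 : 0 <= C * (enorm u * mass a).
    by apply: mulr_ge0 => //; apply: mulr_ge0; [exact: enorm_ge0|exact: mass_ge0].
  have [a0|/massV a0] := eqVneq a 0.
    by rewrite a0 -[X in dirac_diff _ _ X](scale0r 0) dirac_diffZ scale0r linear0 normr0 -a0.
  have [u0|un0] := eqVneq u 0.
    by rewrite /dirac_diff {1}u0 addr0 subrr linear0 normr0.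
  have eu : 0 < enorm u.
    rewrite /enorm sqrtr_gt0 lt_def; apply/andP; split; last first.
      by apply: sumr_ge0 => i _; rewrite -expr2 sqr_ge0.
    apply: contra un0; rewrite psumr_eq0 => [/allP H|i _]; last by rewrite -expr2 sqr_ge0.
    apply/eqP/rowP => i; rewrite mxE; apply/eqP.
    by have := H i (mem_index_enum _); rewrite /= mulf_eq0 orbb.
  have m0 : 0 < enorm u * mass a by rewrite mulr_gt0.
  have /H2 : [set r | exists u p a,
      enorm u * mass a = 1 /\ r = `|w (dirac_diff u p a)|]
      `|w (dirac_diff u p ((enorm u * mass a)^-1 *: a))|.
    exists u, p, ((enorm u * mass a)^-1 *: a); split => //.
    rewrite massE seminormZ -massE mulrCA normfV ger0_norm ?ltW// mulVf//.
    by rewrite gt_eqF.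
  rewrite dirac_diffZ linearZ/= normrM normfV (gtr0_norm m0) => H.
  by move: (le_trans H CC2); rewrite ler_pdivrMl// mulrC.
exists C => A; have [C00|Cn0] := eqVneq C 0.
  have [r [ur Hr]] := dirac_chain_supp A.
  rewrite {1}(dirac_chain_decomp ur Hr) linear_sum big1 ?normr0 ?C00 ?mul0r//.
  move=> p _; apply/normr0_eq0/eqP; rewrite eq_le normr_ge0 andbT.
  by have := b1 p (A p); rewrite C00 mul0r.
have Cp : 0 < C by rewrite lt_def Cn0.
rewrite -ler_pdivrMl//; apply: lb_le_inf; first exact: B1_set_neq0.
move=> _ [s [t -> ->]]; rewrite ler_pdivrMl// linearD/= !linear_sum/=.
apply: le_trans (ler_normD _ _) _; rewrite /B1_weight mulrDr !mulr_sumr.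
by apply: lerD; apply: le_trans (ler_norm_sum _ _ _) _; apply: ler_sum => x _.
Qed.

Lemma cvg_chain_integral (w : kform) (J : Bhat) (A : nat -> dirac_chain) :
  B1_form w -> to_Bhat (A i) @[i --> \oo] --> J ->
  w (A i) @[i --> \oo] --> chain_integral J w.
Proof.
move=> /B1_form_bounded[C HC] AJ.
pose K := `|C| + 1.
have K0 : 0 < K by rewrite /K ltr_wpDl.
have HK B : `|w B| <= K * `|to_Bhat B|.
  rewrite norm_to_completion; apply: le_trans (HC B) _.
  rewrite B1_seminormE ler_wpM2r// ?(seminorm_ge0 B1_seminorm)//.
  by rewrite /K (le_trans (ler_norm _))// lerDl.
have key (B B' : nat -> dirac_chain) :
    to_Bhat (B i) @[i --> \oo] --> J -> to_Bhat (B' i) @[i --> \oo] --> J ->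
    w (B i) - w (B' i) @[i --> \oo] --> (0 : R).
  move=> BJ B'J; apply/cvgrPdist_lt => e e0.
  have e2 : 0 < e / K by rewrite divr_gt0.
  have H0 : to_Bhat (B i) - to_Bhat (B' i) @[i --> \oo] --> (0 : Bhat).
    by rewrite -(subrr J); exact: cvgB.
  have /cvgrPdist_lt /(_ _ e2)[M _ H] := H0.
  exists M => // i /H /=; rewrite !sub0r !normrN -linearB/= => H'.
  rewrite -linearB; apply: le_lt_trans (HK _) _.
  by rewrite mulrC -ltr_pdivlMr// linearB.
have cvgA : cvgn (fun i => w (A i)).
  apply: cauchy_cvg; apply: cauchy_exP => e e0.
  have e2 : 0 < e / K / 2 by rewrite !divr_gt0.
  have /cvgrPdist_lt /(_ _ e2)[M _ H] := AJ.
  exists (w (A M)); exists M => // i /= Mi.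
  rewrite /ball/= -linearB; apply: le_lt_trans (HK _) _.
  rewrite mulrC -ltr_pdivlMr// linearB.
  apply: le_lt_trans (ler_distD J _ _) _.
  by rewrite [e / K]splitr ltrD ?(distrC _ J)// ?H//=.
suff : [set l | forall A : nat -> dirac_chain,
    to_Bhat (A i) @[i --> \oo] --> J -> w (A i) @[i --> \oo] --> l]
    (limn (fun i => w (A i))).
  by move=> /getI; exact.
move=> B BJ.
have -> : (fun i => w (B i)) = (fun i => (w (B i) - w (A i)) + w (A i)).
  by apply/funext => i; rewrite subrK.
rewrite -[X in _ --> X]add0r; apply: cvgD; first exact: key.
exact: cvgA.
Qed.

End dirac_chain.

Section lebesgue_tuple.
Variable R : realType.
Local Open Scope ereal_scope.
Local Notation M := (measurableTypeR R).

Definition cons_tuple n (x : M * n.-tuple M) : n.+1.-tuple M :=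
  [tuple of x.1 :: x.2].

Lemma measurable_cons_tuple n : measurable_fun [set: _] (@cons_tuple n).
Proof. by apply: measurable_cons. Qed.

Section step.
Variables (n : nat) (mu : {sigma_finite_measure set (n.-tuple M) -> \bar R}).

Definition lebesgue_step : set (n.+1.-tuple M) -> \bar R :=
  pushforward (@lebesgue_measure R \x mu) (@cons_tuple n).

HB.instance Definition _ := Measure.copy lebesgue_step
  (measure_function_pushforward__canonical__measure_function_Measure
    (@lebesgue_measure R \x mu) (@measurable_cons_tuple n)).

Lemma lebesgue_step_sigma_finite : sigma_finite setT lebesgue_step.
Proof.
have /sigma_finiteP[F [TF ndF Foo]] := sigma_finiteT (@lebesgue_measure R).
have /sigma_finiteP[G [TG ndG Goo]] := sigma_finiteT mu.
pose g (t : n.+1.-tuple M) : M * n.-tuple M := (thead t, [tuple of behead t]).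
have mg : measurable_fun [set: _] g.
  apply/measurable_fun_pairP; split; first exact: measurable_tnth.
  exact: measurable_behead.
have cK : cancel (@cons_tuple n) g.
  by move=> [x t]; rewrite /g/= theadE; congr pair; apply/val_inj.
exists (fun i => g @^-1` (F i `*` G i)).
  rewrite -preimage_bigcup -[LHS](preimage_setT g); congr (_ @^-1` _).
  apply/seteqP; split=> // -[x y] _.
  have [i _ Fx] : (\bigcup_i F i) x by rewrite -TF.
  have [j _ Gy] : (\bigcup_i G i) y by rewrite -TG.
  exists (maxn i j) => //; split => /=.
    by move: x Fx; exact/subsetPset/ndF/leq_maxl.
  by move: y Gy; exact/subsetPset/ndG/leq_maxr.
move=> i; have [mF Fi] := Foo i; have [mG Gi] := Goo i; split.
  by rewrite -[X in measurable X]setTI; apply: mg => //; exact: measurableX.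
rewrite /lebesgue_step /pushforward -comp_preimage (_ : g \o _ = idfun); last first.
  by apply/funext => x /=; rewrite cK.
by rewrite preimage_id product_measure1E// lte_mul_pinfty// ge0_fin_numE.
Qed.

HB.instance Definition _ :=
  Measure_isSigmaFinite.Build _ _ _ lebesgue_step lebesgue_step_sigma_finite.

End step.

(* Lebesgue measure on R^n, as the n-fold product measure; its values on boxes
   are given by lebesgue_tuple_box. *)
Fixpoint lebesgue_tuple n : {sigma_finite_measure set (n.-tuple M) -> \bar R} :=
  if n is m.+1 then @lebesgue_step m (lebesgue_tuple m)
  else dirac [tuple].

Lemma lebesgue_tuple_box n (A : 'I_n -> set M) : (forall i, measurable (A i)) ->
  lebesgue_tuple n [set t | forall i, A i (tnth t i)] =
  \prod_(i < n) @lebesgue_measure R (A i).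
Proof.
elim: n A => [|n IH] A mA.
  by rewrite big_ord0 /= diracE mem_set// => -[].
rewrite big_ord_recl -IH//= /lebesgue_step /pushforward.
rewrite -product_measure1E//; last first.
  rewrite (_ : mkset _ = \bigcap_(i in [set: 'I_n])
      ((fun t : n.-tuple M => tnth t i) @^-1` A (lift ord0 i))).
    apply: fin_bigcap_measurable => // i _.
    by rewrite -[X in measurable X]setTI; exact: measurable_tnth.
  by apply/seteqP; split => [t H i _|t H i]; exact: H.
congr product_measure1; apply/seteqP; split => -[x t] /=.
  move=> H; split; first by have := H ord0.
  by move=> i; have := H (lift ord0 i); rewrite /cons_tuple tnthS.
move=> [H0 H] i; have [<-|/unlift_some[j -> _]] := eqVneq ord0 i; first exact: H0.
by rewrite /cons_tuple tnthS; exact: H.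
Qed.

End lebesgue_tuple.

Section vector_field.
Variables (R : realType) (n : nat).
Local Notation E := ('rV[R]_n).

(* The space B^1_0 seen as a space of functions: bounded_lipschitzP identifies
   these functions with the values w (p; 1) of the 0-forms w in B^1_0. *)
Definition bounded_lipschitz (f : E -> R) : Prop :=
  (exists M, forall p, `|f p| <= M) /\
  (exists L, forall p q, `|f p - f q| <= L * enorm (p - q)).

(* X p is the Dirac chain sum_I (p; f_I(p) a_I), so that a k-form w can be applied
   to it directly; w (X p) = sum_I f_I(p) w (p; a_I) is form_field. *)
Definition is_B01_field (k : nat) (X : E -> dirac_chain R n k) : Prop :=
  exists (m : nat) (a : m.-tuple (kvector R n k)) (f : 'I_m -> E -> R),
    [/\ basis_of fullv a, forall i, bounded_lipschitz (f i) &
        forall p, X p = \sum_(i < m) dirac_elem p (f i p *: tnth a i)].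

Definition compactly_supported (k : nat) (X : E -> dirac_chain R n k) : Prop :=
  compact (closure [set p | X p != 0]).

Definition row_of_tuple (t : n.-tuple (measurableTypeR R)) : E :=
  \row_i tnth t i.

Definition represents (k : nat) (J : Bhat R n k) (X : E -> dirac_chain R n k) : Prop :=
  forall w : kform R n k, B1_form w ->
    chain_integral J w = \int[lebesgue_tuple R n]_t w (X (row_of_tuple t)).

Lemma form_field k m (w : kform R n k) (a : m.-tuple (kvector R n k))
    (f : 'I_m -> E -> R) p :
  w (\sum_(i < m) dirac_elem p (f i p *: tnth a i)) =
  \sum_(i < m) f i p * w (dirac_elem p (tnth a i)).
Proof.
by rewrite linear_sum; apply: eq_bigr => i _; rewrite diracZ linearZ.
Qed.

Lemma B1_norm_dirac k p (a : kvector R n k) : B1_norm (dirac_elem p a) <= mass a.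
Proof.
apply: ge_inf.
  exists 0 => _ [s [t _ ->]]; apply: addr_ge0; apply: sumr_ge0 => x _.
    exact: mass_ge0.
  by apply: mulr_ge0; [exact: enorm_ge0|exact: mass_ge0].
exists [:: (p, a)], [::]; last by rewrite /B1_weight big_seq1 big_nil addr0.
by rewrite /B1_decomposition big_seq1 big_nil addr0.
Qed.

Lemma B1_norm_dirac_diff k u p (a : kvector R n k) :
  B1_norm (dirac_diff u p a) <= enorm u * mass a.
Proof.
apply: ge_inf.
  exists 0 => _ [s [t _ ->]]; apply: addr_ge0; apply: sumr_ge0 => x _.
    exact: mass_ge0.
  by apply: mulr_ge0; [exact: enorm_ge0|exact: mass_ge0].
exists [::], [:: (u, p, a)]; last by rewrite /B1_weight big_seq1 big_nil add0r.
by rewrite /B1_decomposition big_seq1 big_nil add0r.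
Qed.

Definition one_kvector : kvector R n 0 := [ffun=> 1].

Definition nil_index : multi_index n 0 := exist _ [tuple] isT.

Lemma multi_index0 (J : multi_index n 0) : J = nil_index.
Proof. by apply/val_inj; rewrite /= [val J]tuple0. Qed.

Lemma simple0 (a : kvector R n 0) : simple a.
Proof.
exists (a nil_index), (fun=> 0); apply/ffunP => J.
by rewrite !ffunE (multi_index0 J) det_mx00 [RHS]mulr1.
Qed.

Lemma mass0 (a : kvector R n 0) : mass a = `|a nil_index|.
Proof.
rewrite (mass_simple (simple0 a)) /knorm /dotk (bigD1 nil_index)//= big1.
  by rewrite addr0 -expr2 sqrtr_sqr.
by move=> J; rewrite (multi_index0 J) eqxx.
Qed.

Lemma bounded_lipschitzP (f : E -> R) : bounded_lipschitz f <->
  exists2 w : kform R n 0, B1_form w & forall p, f p = w (dirac_elem p one_kvector).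
Proof.
have m1 : mass one_kvector = 1 by rewrite mass0 ffunE normr1.
split; last first.
  move=> [w /B1_form_bounded[C HC] fw].
  have {}HC A : `|w A| <= `|C| * B1_norm A.
    apply: le_trans (HC A) _; rewrite ler_wpM2r ?ler_norm//.
    exact: (seminorm_ge0 (B1_seminorm R n 0)).
  split.
    exists `|C| => p; rewrite fw; apply: le_trans (HC _) _.
    by rewrite -[leRHS]mulr1 ler_wpM2l// -m1 B1_norm_dirac.
  exists `|C| => p q; rewrite !fw -linearB.
  have -> : dirac_elem p one_kvector - dirac_elem q one_kvector =
      dirac_diff (p - q) q one_kvector by rewrite /dirac_diff [q + _]addrC subrK.
  apply: le_trans (HC _) _; rewrite ler_wpM2l//.
  by rewrite -[leRHS]mulr1 -m1 B1_norm_dirac_diff.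
move=> [[M HM] [L HL]].
have supp A := cid (@dirac_chain_supp R n 0 A).
pose w (A : dirac_chain R n 0) : R^o := \sum_(p <- sval (supp A)) f p * A p nil_index.
have wE (A : dirac_chain R n 0) (r : seq E) : uniq r -> (forall p, A p != 0 -> p \in r) ->
    w A = \sum_(p <- r) f p * A p nil_index.
  move=> ur Hr; rewrite /w; case: (supp A) => r' /= [ur' Hr'].
  have H (s : seq E) : \sum_(p <- s) f p * A p nil_index =
      \sum_(p <- [seq p <- s | A p != 0]) f p * A p nil_index.
    rewrite big_filter [LHS](bigID (fun p => A p != 0))/= [X in _ + X]big1 ?addr0//.
    by move=> p; rewrite negbK => /eqP ->; rewrite ffunE mulr0.
  rewrite H [RHS]H; apply: perm_big; apply: uniq_perm; rewrite ?filter_uniq//.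
  by move=> p; rewrite !mem_filter; case: eqVneq => //= Ap; rewrite Hr// Hr'.
have wlin : scalar w.
  move=> c A B; have [rA [uA HA]] := supp A; have [rB [uB HB]] := supp B.
  pose r := undup (rA ++ rB).
  have HrA (p : E) : A p != 0 -> p \in r by rewrite mem_undup mem_cat => /HA ->.
  have HrB (p : E) : B p != 0 -> p \in r by rewrite mem_undup mem_cat orbC => /HB ->.
  rewrite !(wE _ r) ?undup_uniq//; last first.
    move=> p H; have [Ap|] := eqVneq (A p) 0; last exact: HrA.
    apply: HrB; apply: contraNneq H => Bp.
    by rewrite dirac_chainD dirac_chainZ Ap Bp scaler0 addr0.
  rewrite mulr_sumr -big_split; apply: eq_bigr => p _.
  have -> : (c *: A + B) p nil_index = c * A p nil_index + B p nil_index.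
    by rewrite dirac_chainD dirac_chainZ !ffunE.
  by rewrite mulrDr mulrCA.
pose W : kform R n 0 := HB.pack w (GRing.isLinear.Build _ _ _ _ w wlin).
have WE (p : E) (a : kvector R n 0) : W (dirac_elem p a) = f p * a nil_index.
  rewrite -[LHS]/(w _) (wE _ [:: p])//; first by rewrite big_seq1/= eqxx.
  by move=> q /=; rewrite inE; have [//|_] := eqVneq q p; rewrite /= eqxx.
exists W; last by move=> p; rewrite WE ffunE mulr1.
split.
  exists M => _ [p [a [ma ->]]].
  by rewrite WE normrM -mass0 ma mulr1.
exists L => _ [u [p [a [ma ->]]]].
rewrite linearB !WE -mulrBl normrM -mass0.
have := HL (p + u) p; rewrite addrAC subrr add0r => H.
apply: le_trans (ler_wpM2r (mass_ge0 a) H) _.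
by rewrite -mulrA ma mulr1.
Qed.

End vector_field.

(* Main.v *)
Require Import Defs.
From HB Require Import structures.
From mathcomp Require Import all_boot all_order all_algebra.
From mathcomp Require Import all_classical all_reals all_analysis.
From mathcomp Require Import measurable_realfun ring lra.

Set Implicit Arguments.
Unset Strict Implicit.
Unset Printing Implicit Defensive.

Import Order.TTheory GRing.Theory Num.Theory.
Import numFieldNormedType.Exports.

Local Open Scope classical_set_scope.
Local Open Scope ring_scope.

(** The chain representing X is the limit of the Riemann sums of the map
    p |-> X p, seen as a map from R^n to the Dirac chains with the B^1 norm.

    This map is Lipschitz (B01_field_lipschitz): moving a Dirac mass costs at
    most the displacement times its mass, and changing its coefficient costs at
    most the change, so
    |(p; c a) - (q; c' a)| <= (|c| |p - q| + |c - c'|) mass(a).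
    It vanishes outside a cube of finite Lebesgue measure. Hence, for a form w
    with |w A| <= C |A|, the real function w (X p) has oscillation at most C e on
    the cells of a grid on which X has oscillation at most e, and w of the
    Riemann sum of X is within C e vol(cube) of the integral of w (X p)
    (riemann_sum_error).

    That the Riemann sums are Cauchy in the B^1 norm follows from the same
    estimate: by the Hahn-Banach theorem the norm of a difference A - B of two of
    them is phi A - phi B for a functional phi dominated by the norm, and both
    phi A and phi B are close to the integral of phi (X p), so the two grids are
    never compared with each other (riemann_sum_cauchy).

    Uniqueness is Hahn-Banach again, in the completion: the functional that norms
    J1 - J2 restricts to a form in B^1 on Dirac chains, so two chains on which
    all these forms have the same integrals coincide (chain_integral_inj). *)

(** * Norming functionals *)

Section hahn_banach.
Variables (R : realType) (V : lmodType R).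
Implicit Types (p q : V -> R) (x y : V).

(** Only the inequality q (a *: x) <= a * q x for a > 0 is asked for, so that
    infima of sublinear functions are seen to be sublinear directly; equality
    for a >= 0 follows, see sublinearZ. *)
Definition sublinear q : Prop :=
  (forall x y, q (x + y) <= q x + q y) /\
  (forall a x, 0 < a -> q (a *: x) <= a * q x).

Lemma sublinear0 q : sublinear q -> q 0 = 0.
Proof.
move=> [_ qZ]; have := qZ 2 0; have := qZ 2^-1 0; rewrite !scaler0.
by move=> /(_ ltac:(lra)) + /(_ ltac:(lra)); lra.
Qed.

Lemma sublinearZ q a x : sublinear q -> 0 <= a -> q (a *: x) = a * q x.
Proof.
move=> sq; rewrite le_eqVlt => /predU1P[<-|a0].
  by rewrite scale0r mul0r sublinear0.
apply/eqP; rewrite eq_le sq.2//= -ler_pdivlMl//.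
rewrite -{1}[x](scalerK (lt0r_neq0 a0)).
by apply: sq.2; rewrite invr_gt0.
Qed.

Lemma sublinear_ge q x : sublinear q -> - q (- x) <= q x.
Proof. by move=> sq; have := sq.1 x (- x); rewrite subrr sublinear0//; lra. Qed.

Section tilt.
Variables (q : V -> R) (y : V).
Hypothesis sq : sublinear q.

(** The function tilt is the largest sublinear function below q whose value at
    - y is at most - q y: it makes q linear along y. *)
Definition tilt x : R :=
  inf [set r | exists2 t, 0 <= t & r = q (x + t *: y) - t * q y].

Let tilt_lbound x :
  lbound [set r | exists2 t, 0 <= t & r = q (x + t *: y) - t * q y] (- q (- x)).
Proof.
move=> _ [t t0 ->]; rewrite -(sublinearZ y sq t0).
have := sq.1 (x + t *: y) (- x); rewrite addrAC subrr add0r; lra.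
Qed.

Lemma tilt_le x t : 0 <= t -> tilt x <= q (x + t *: y) - t * q y.
Proof. by move=> t0; apply: ge_inf; [exists (- q (- x))|exists t]. Qed.

Lemma le_tilt x r :
  (forall t, 0 <= t -> r <= q (x + t *: y) - t * q y) -> r <= tilt x.
Proof.
move=> H; apply: lb_le_inf; last by move=> _ [t t0 ->]; exact: H.
by exists (q (x + 0 *: y) - 0 * q y), 0.
Qed.

Lemma tilt_le_id x : tilt x <= q x.
Proof. by have := @tilt_le x 0 (lexx 0); rewrite scale0r addr0 mul0r subr0. Qed.

Lemma tilt_opp : tilt (- y) <= - q y.
Proof.
have := @tilt_le (- y) 1 ler01.
by rewrite scale1r addNr mul1r sublinear0// sub0r.
Qed.

Lemma tilt_sublinear : sublinear tilt.
Proof.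
split=> [x z|a x a0].
  rewrite -lerBlDr; apply: le_tilt => s s0.
  rewrite lerBlDr -lerBlDl; apply: le_tilt => t t0.
  have := @tilt_le (x + z) (s + t) (addr_ge0 s0 t0).
  have := sq.1 (x + s *: y) (z + t *: y).
  rewrite addrACA -scalerDl; lra.
rewrite -ler_pdivrMl//; apply: le_tilt => t t0; rewrite ler_pdivrMl//.
have := @tilt_le (a *: x) (a * t) (mulr_ge0 (ltW a0) t0).
rewrite -scalerA -scalerDr (sublinearZ _ sq (ltW a0)); lra.
Qed.

End tilt.

(** Minimality gives tilt q y = q, and the term t = 1 of the infimum then reads
    q x <= q (x + y) - q y, which is the missing half of additivity. *)
Lemma minimal_sublinear_linear q : sublinear q ->
  (forall q', sublinear q' -> (forall x, q' x <= q x) -> q' = q) -> scalar q.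
Proof.
move=> sq qmin.
have qD x y : q (x + y) = q x + q y.
  apply/eqP; rewrite eq_le sq.1/=.
  have := @tilt_le q y sq x 1 ler01.
  rewrite (qmin _ (tilt_sublinear y sq) (tilt_le_id y sq)) scale1r mul1r; lra.
have qN x : q (- x) = - q x.
  by have := qD x (- x); rewrite subrr sublinear0//; lra.
move=> a x y; rewrite qD; congr (_ + _); have [a0|a0] := leP 0 a.
  exact: sublinearZ.
by rewrite -[a]opprK scaleNr qN sublinearZ ?mulNr// oppr_ge0 ltW.
Qed.

(** By Zorn's lemma there is a minimal sublinear function below p: a chain is
    bounded below by its pointwise infimum, which is finite because
    - p (- x) <= q x for all sublinear q below p. *)
Lemma sublinear_linear_minorant p : sublinear p ->
  exists phi : {scalar V}, forall x, phi x <= p x.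
Proof.
move=> sp; pose T := {q | sublinear q /\ forall x, q x <= p x}.
pose ge (s t : T) := `[< forall x, sval t x <= sval s x >].
have ge_anti s t : ge s t -> ge t s -> s = t.
  move=> /asboolP st /asboolP ts.
  case: s t st ts => [s ps] [t pt] /= st ts; apply: eq_exist; apply/funext => x.
  by apply/eqP; rewrite eq_le st ts.
have [s|r s t /asboolP rs /asboolP st|s t||[q [sq qp]] qmin] := @Zorn T ge.
- exact/asboolP.
- by apply/asboolP => x; exact: le_trans (st x) (rs x).
- exact: ge_anti.
- move=> A Atot; have [[t0 At0]|A0] := pselect (A !=set0); last first.
    by exists (exist _ p (conj sp (fun x => lexx _))) => s As; case: A0; exists s.
  pose S x := [set sval t x | t in A].
  have S0 x : S x !=set0 by exists (sval t0 x), t0.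
  have Slb x : lbound (S x) (- p (- x)).
    move=> _ [t At <-]; have [st tp] := svalP t.
    by apply: le_trans (sublinear_ge x st); rewrite lerN2.
  have gS x t : A t -> inf (S x) <= sval t x.
    by move=> At; apply: ge_inf; [exists (- p (- x))|exists t].
  have sg : sublinear (fun x => inf (S x)).
    split=> [x y|a x a0].
      rewrite -lerBlDr; apply: lb_le_inf => // _ [s As <-].
      rewrite lerBlDr -lerBlDl; apply: lb_le_inf => // _ [t At <-].
      rewrite lerBlDl.
      have [/asboolP st|/asboolP ts] := Atot _ _ As At.
        have := (svalP t).1.1 x y; have := gS (x + y) _ At; have := st x; lra.
      have := (svalP s).1.1 x y; have := gS (x + y) _ As; have := ts y; lra.
    rewrite -ler_pdivrMl//; apply: lb_le_inf => // _ [t At <-].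
    rewrite ler_pdivrMl//; apply: le_trans (gS _ _ At) _.
    exact: (svalP t).1.2.
  have gp x : inf (S x) <= p x.
    exact: le_trans (gS x _ At0) ((svalP t0).2 x).
  exists (exist _ (fun x => inf (S x)) (conj sg gp)) => t At; apply/asboolP => x.
  exact: gS.
- have lq : scalar q.
    apply: minimal_sublinear_linear => // q' sq' q'q.
    have q'p x : q' x <= p x by exact: le_trans (q'q x) (qp x).
    suff /qmin/(congr1 sval) : ge (exist _ q (conj sq qp)) (exist _ q' (conj sq' q'p)).
      by [].
    exact/asboolP.
  pose phi : {scalar V} := HB.pack (q : V -> R^o) (GRing.isLinear.Build _ _ _ _ _ lq).
  by exists phi.
Qed.

(** A linear function below tilt N v is dominated by N and is at most - N v at
    - v, that is, at least N v at v. *)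
Lemma norming_functional (N : seminorm V) v : exists phi : {scalar V},
  (forall x, `|phi x| <= N x) /\ phi v = N v.
Proof.
have sN : sublinear N.
  split=> [|a x a0]; first exact: seminormD.
  by rewrite seminormZ gtr0_norm.
have [phi phiN] := sublinear_linear_minorant (tilt_sublinear v sN).
have {}phi_le x : phi x <= N x := le_trans (phiN x) (tilt_le_id v sN x).
exists phi; split=> [x|].
  by rewrite ler_norml phi_le andbT lerNl -linearN -(seminormN N) phi_le.
apply/eqP; rewrite eq_le phi_le/= -lerN2 -linearN.
exact: le_trans (phiN _) (tilt_opp v sN).
Qed.

End hahn_banach.

(** * Riemann sums over finite measurable partitions *)

(** Cells may be empty, hence sample points are arbitrary points of T; they are
    tied to their cells by oscillation bounds on h t - h (sample P i). *)
Record tagged_partition d (T : measurableType d) (D : set T) := TaggedPartition {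
  cell_index : finType;
  cell : cell_index -> set T;
  sample : cell_index -> T;
  measurable_cell : forall i, measurable (cell i);
  trivIset_cell : trivIset setT cell;
  cover_cell : \bigcup_i cell i = D }.

Arguments cell {d T D} P i : rename.
Arguments sample {d T D} P i : rename.
Arguments measurable_cell {d T D} P i : rename.
Arguments trivIset_cell {d T D} P : rename.
Arguments cover_cell {d T D} P : rename.

Section riemann_sum.
Context d (T : measurableType d) (R : realType).
Implicit Types (mu : {measure set T -> \bar R}) (D : set T).

Lemma cell_subset D (P : tagged_partition D) i : cell P i `<=` D.
Proof. by move=> t it; rewrite -(cover_cell P); exists i. Qed.

Lemma in_cell D (P : tagged_partition D) t : D t -> exists i, cell P i t.
Proof.
move=> Dt; have [i _ it] : (\bigcup_i cell P i) t by rewrite cover_cell.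
by exists i.
Qed.

Definition riemann_sum mu D (P : tagged_partition D) (V : lmodType R) (F : T -> V) : V :=
  \sum_i fine (mu (cell P i)) *: F (sample P i).

Lemma riemann_sum_linear mu D (P : tagged_partition D) (V : lmodType R)
    (phi : {scalar V}) (F : T -> V) :
  phi (riemann_sum mu P F) = riemann_sum mu P (phi \o F : T -> R^o).
Proof. by rewrite linear_sum; apply: eq_bigr => i _; rewrite linearZ. Qed.

Section step_function.
Variables (D : set T) (P : tagged_partition D) (h : T -> R).

Definition step_function (t : T) : R := \sum_i h (sample P i) * \1_(cell P i) t.

Lemma step_function_cell i t : cell P i t -> step_function t = h (sample P i).
Proof.
move=> it; rewrite /step_function (bigD1 i)//= indicE mem_set// mulr1.
rewrite big1 ?addr0// => j ji; rewrite indicE memNset ?mulr0// => jt.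
move/eqP: ji; apply.
by apply: (trivIset_cell P) => //; exists t.
Qed.

Lemma measurable_step_function : measurable_fun D step_function.
Proof.
apply: measurable_sum => i; apply: measurable_funM => //.
exact/measurable_indic/measurable_cell.
Qed.

Lemma step_function_bounded : [bounded step_function t | t in D].
Proof.
exists (\sum_i `|h (sample P i)|); split; first exact: num_real.
move=> M hM t Dt; apply: le_trans (ltW hM); apply: le_trans (ler_norm_sum _ _ _) _.
apply: ler_sum => i _; rewrite normrM indicE.
by rewrite ler_piMr// normr_nat; case: (_ \in _).
Qed.

End step_function.

Section integral.
Variables (mu : {measure set T -> \bar R}) (D : set T).
Hypotheses (mD : measurable D) (finD : (mu D < +oo)%E).

Lemma integrable_step_function (P : tagged_partition D) (h : T -> R) :
  mu.-integrable D (EFin \o step_function P h).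
Proof.
apply: measurable_bounded_integrable => //; first exact: measurable_step_function.
exact: step_function_bounded.
Qed.

Lemma Rintegral_step_function (P : tagged_partition D) (h : T -> R) :
  \int[mu]_(t in D) step_function P h t = riemann_sum mu P (h : T -> R^o).
Proof.
have ci i : (mu (cell P i) < +oo)%E.
  apply: le_lt_trans finD; apply: le_measure; rewrite ?inE//.
    exact: measurable_cell.
  exact: cell_subset.
have int_cell i : mu.-integrable D (fun t => (h (sample P i) * \1_(cell P i) t)%:E).
  apply: measurable_bounded_integrable => //.
    by apply: measurable_funM => //; exact/measurable_indic/measurable_cell.
  exists `|h (sample P i)|; split => // M hM t Dt.
  apply: le_trans (ltW hM); rewrite normrM indicE.
  by rewrite ler_piMr// normr_nat; case: (_ \in _).
rewrite /Rintegral.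
under eq_integral do rewrite -sumEFin.
rewrite integral_sum//.
rewrite (eq_bigr (fun i => (fine (mu (cell P i)) * h (sample P i))%:E)); last first.
  move=> i _; under eq_integral do rewrite EFinM.
  rewrite integralZl//.
    rewrite integral_indic//; last exact: measurable_cell.
    rewrite setIidl; last exact: cell_subset.
    rewrite muleC EFinM fineK//.
    by rewrite ge0_fin_numE.
  apply: measurable_bounded_integrable => //.
    exact/measurable_indic/measurable_cell.
  exists 1; split => // M hM t Dt.
  by apply: le_trans (ltW hM); rewrite indicE normr_nat; case: (_ \in _).
by rewrite sumEFin.
Qed.

Lemma cell_osc_step (P : tagged_partition D) (h : T -> R) e :
  (forall i t, cell P i t -> `|h t - h (sample P i)| <= e) ->
  forall t, D t -> `|h t - step_function P h t| <= e.
Proof.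
move=> he t /(in_cell P)[i it].
by rewrite (step_function_cell _ it) he.
Qed.

(** A Riemann sum is the integral of the step function of the sampled values,
    which is uniformly close to h on D. *)
Lemma riemann_sum_dist (P : tagged_partition D) (h : T -> R) e :
  mu.-integrable D (EFin \o h) ->
  (forall i t, cell P i t -> `|h t - h (sample P i)| <= e) ->
  `|\int[mu]_(t in D) h t - riemann_sum mu P (h : T -> R^o)| <= e * fine (mu D).
Proof.
move=> ih /cell_osc_step he; rewrite -Rintegral_step_function.
have ist := integrable_step_function P h.
have ihs : mu.-integrable D (EFin \o (fun t => h t - step_function P h t)).
  by have := integrableB mD ih ist.
rewrite -RintegralB//; apply: le_trans (le_normr_Rintegral mD ihs) _.
rewrite -Rintegral_cst//; apply: le_Rintegral => //.
  exact: integrable_norm ihs.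
apply: measurable_bounded_integrable => //.
exists `|e|; split => // M eM t _; exact: ltW.
Qed.

(** The function h is measurable on D as a uniform limit of its step functions,
    and bounded because one of these is at bounded distance from it. *)
Lemma integrable_cell_osc (P : nat -> tagged_partition D) (h : T -> R) (e : nat -> R) :
  e @ \oo --> (0 : R) ->
  (forall m i t, cell (P m) i t -> `|h t - h (sample (P m) i)| <= e m) ->
  mu.-integrable D (EFin \o h).
Proof.
move=> e0 /(fun H m => cell_osc_step (H m)) he.
have mh : measurable_fun D h.
  apply: (@measurable_fun_cvg _ _ _ _ (fun m => step_function (P m) h)).
    by move=> m; exact: measurable_step_function.
  move=> t Dt; apply/cvgrPdist_le => r r0.
  have /cvgrPdist_lt/(_ _ r0) := e0.
  apply: filterS => m; rewrite sub0r normrN => em.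
  exact: le_trans (he m t Dt) (le_trans (ler_norm _) (ltW em)).
apply: measurable_bounded_integrable => //.
have [M [_ HM]] := step_function_bounded (P 0%N) h.
exists (M + 1 + e 0%N); split; first exact: num_real.
move=> K hK t Dt /=.
have := ler_normD (h t - step_function (P 0%N) h t) (step_function (P 0%N) h t).
rewrite subrK; have := he 0%N t Dt; have := HM (M + 1) (ltr_pwDr ltr01 (lexx _)) t Dt.
rewrite /=; lra.
Qed.

End integral.
End riemann_sum.

Section riemann_limit.
Context d (T : measurableType d) (R : realType).
Variables (mu : {measure set T -> \bar R}) (D : set T).
Hypotheses (mD : measurable D) (finD : (mu D < +oo)%E).
Variables (V : lmodType R) (N : seminorm V) (F : T -> V).
Variables (P : nat -> tagged_partition D) (e : nat -> R).
Hypotheses (e0 : e @ \oo --> (0 : R))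
  (Fe : forall m i t, cell (P m) i t -> N (F t - F (sample (P m) i)) <= e m).

Lemma riemann_sum_error (phi : {scalar V}) (C : R) :
  0 <= C -> (forall v, `|phi v| <= C * N v) -> forall m,
  `|\int[mu]_(t in D) phi (F t) - phi (riemann_sum mu (P m) F)|
    <= C * e m * fine (mu D).
Proof.
move=> C0 phiC; have osc m i t : cell (P m) i t ->
    `|phi (F t) - phi (F (sample (P m) i))| <= C * e m.
  move=> it; rewrite -linearB; apply: le_trans (phiC _) _.
  by rewrite ler_wpM2l// Fe.
have Ce0 : (fun m => C * e m) @ \oo --> (0 : R).
  by rewrite -(mulr0 C); apply: cvgM e0; exact: cvg_cst.
have ih := integrable_cell_osc mD finD Ce0 osc.
move=> m; rewrite riemann_sum_linear.
exact: (riemann_sum_dist mD finD ih (osc m)).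
Qed.

Lemma riemann_sum_cvg (phi : {scalar V}) (C : R) :
  0 <= C -> (forall v, `|phi v| <= C * N v) ->
  phi (riemann_sum mu (P m) F) @[m --> \oo] --> \int[mu]_(t in D) phi (F t).
Proof.
move=> C0 phiC; have err := riemann_sum_error C0 phiC.
have Ce0 : (fun m => C * e m * fine (mu D)) @ \oo --> (0 : R).
  rewrite -(mul0r (fine (mu D))) -(mulr0 C); apply: cvgM; last exact: cvg_cst.
  by apply: cvgM e0; exact: cvg_cst.
apply/cvgrPdist_le => r r0; have /cvgrPdist_lt/(_ _ r0) := Ce0.
apply: filterS => m; rewrite sub0r normrN => em.
exact: le_trans (err m) (le_trans (ler_norm _) (ltW em)).
Qed.

(** The functional norming the difference of two Riemann sums takes on each of
    them a value close to the same integral of phi (F t) over D. *)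
Lemma riemann_sum_cauchy : cauchy_seq N (fun m => riemann_sum mu (P m) F).
Proof.
move=> r r0; have r2 : 0 < r / 2 by rewrite divr_gt0.
have ed0 : (fun m => e m * fine (mu D)) @ \oo --> (0 : R).
  by rewrite -(mul0r (fine (mu D))); apply: cvgM => //; exact: cvg_cst.
have /cvgrPdist_lt/(_ _ r2)[M _ HM] := ed0; exists M => i j Mi Mj.
set A := riemann_sum _ _ _; set B := riemann_sum _ _ _.
have [phi [phiN phiAB]] := norming_functional N (A - B).
have phi1 v : `|phi v| <= 1 * N v by rewrite mul1r.
rewrite -phiAB linearB/=.
have := riemann_sum_error ler01 phi1 i; have := riemann_sum_error ler01 phi1 j.
rewrite -/A -/B !mul1r; have := HM i Mi; have := HM j Mj; rewrite /= !sub0r !normrN.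
move=> /(le_lt_trans (ler_norm _)) bj /(le_lt_trans (ler_norm _)) bi.
by rewrite !ler_norml => /andP[h1 h2] /andP[h3 h4]; lra.
Qed.

End riemann_limit.

(** * Grids on cubes of R^n *)

Section box.
Variables (R : realType) (n : nat).
Local Notation M := (measurableTypeR R).

Lemma measurable_tuple_box (A : 'I_n -> set M) : (forall i, measurable (A i)) ->
  measurable [set t : n.-tuple M | forall i, A i (tnth t i)].
Proof.
move=> mA; rewrite (_ : mkset _ = \bigcap_(i in [set: 'I_n])
    ((fun t : n.-tuple M => tnth t i) @^-1` A i)).
  apply: fin_bigcap_measurable => // i _.
  by rewrite -[X in measurable X]setTI; exact: measurable_tnth.
by apply/seteqP; split => [t H i _|t H i]; exact: H.
Qed.

(** The cube is half-open, so that it is the disjoint union of the cells of a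
    grid of half-open cells. *)
Definition cube (K : R) : set (n.-tuple M) :=
  [set t | forall i, `[- K, K[%classic (tnth t i)].

Lemma measurable_cube K : measurable (cube K).
Proof. by apply: (@measurable_tuple_box (fun=> `[- K, K[%classic)). Qed.

Lemma lebesgue_cube_fin K : (lebesgue_tuple R n (cube K) < +oo)%E.
Proof.
rewrite (@lebesgue_tuple_box R n (fun=> `[- K, K[%classic))//.
have [r ->] : exists r : R, lebesgue_measure `[- K, K[%classic = r%:E.
  by rewrite lebesgue_measure_itv/=; case: ifP => _; eexists; rewrite ?EFinN.
by rewrite prodEFin ltry.
Qed.

Section grid.
Variables (K : R) (m : nat).
Hypothesis K0 : 0 < K.

Let step : R := 2 * K / m.+1%:R.
Let node (j : nat) : R := - K + j%:R * step.

Let step_gt0 : 0 < step. Proof. by rewrite divr_gt0// mulr_gt0. Qed.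

Definition grid_cell (f : {ffun 'I_n -> 'I_m.+1}) : set (n.-tuple M) :=
  [set t | forall i, `[node (f i), node (f i).+1[%classic (tnth t i)].

Definition grid_sample (f : {ffun 'I_n -> 'I_m.+1}) : n.-tuple M :=
  [tuple node (f i) | i < n].

(** The grid interval containing x is found by truncation, which gives
    disjointness and covering of the cells at once. *)
Let node_mem (x : R) (j : nat) :
  (x \in `[node j, node j.+1[) =
  (x \in `[- K, +oo[) && (Num.truncn ((x + K) / step) == j).
Proof.
rewrite !in_itv/= andbT /node; have [Kx|xK] := leP (- K) x; last first.
  apply/negbTE/negP => /andP[h _]; move: h; apply/negP; rewrite -ltNge.
  by rewrite (lt_le_trans xK)// lerDl mulr_ge0// ltW.
rewrite truncn_eq; last by apply: divr_ge0; [rewrite -lerBlDr sub0r|exact: ltW].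
rewrite ler_pdivlMr// ltr_pdivrMr//.
by rewrite -lerBrDl -ltrBlDl opprK.
Qed.

Lemma trivIset_grid : trivIset setT grid_cell.
Proof.
move=> f g _ _ [t [ft gt]]; apply/ffunP => i; apply/val_inj/eqP.
have := ft i; have := gt i; rewrite /= !node_mem.
by move=> /andP[_ /eqP ->] /andP[_ /eqP ->].
Qed.

Let node_max : node m.+1 = K.
Proof. by rewrite /node /step mulrC divfK ?pnatr_eq0//; lra. Qed.

Let node_le : {homo node : i j / (i <= j)%N >-> i <= j}.
Proof. by move=> i j ij; rewrite lerD2l ler_wpM2r ?ler_nat// ltW. Qed.

Lemma cover_grid : \bigcup_f grid_cell f = cube K.
Proof.
apply/seteqP; split=> t => [[f _ ft] i|Kt].
  have := ft i; rewrite /= !in_itv/= => /andP[h1 h2]; apply/andP; split.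
    by apply: le_trans h1; rewrite lerDl mulr_ge0// ltW.
  by apply: lt_le_trans h2 _; rewrite -node_max node_le.
pose c i := Num.truncn ((tnth t i + K) / step).
have cm i : (c i < m.+1)%N.
  have := Kt i; rewrite /= in_itv/= => /andP[h1 h2].
  rewrite truncn_lt_nat; last by apply: divr_ge0; [rewrite -lerBlDr sub0r|exact: ltW].
  by rewrite ltr_pdivrMr// /step mulrC divfK ?pnatr_eq0//; lra.
exists [ffun i => Ordinal (cm i)] => // i; rewrite /= node_mem ffunE/= eqxx andbT.
by have := Kt i; rewrite /= !in_itv/= => /andP[->].
Qed.

Lemma measurable_grid_cell f : measurable (grid_cell f).
Proof.
exact: (@measurable_tuple_box (fun i => `[node (f i), node (f i).+1[%classic)).
Qed.

Definition grid : tagged_partition (cube K) :=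
  TaggedPartition grid_sample measurable_grid_cell trivIset_grid cover_grid.

Lemma grid_dist f (t : n.-tuple M) : cell grid f t ->
  enorm (row_of_tuple t - row_of_tuple (sample grid f)) <= Num.sqrt n%:R * step.
Proof.
move=> ft; have -> : Num.sqrt n%:R * step = Num.sqrt (n%:R * step ^+ 2).
  by rewrite sqrtrM// sqrtr_sqr gtr0_norm.
rewrite /enorm; apply: ler_wsqrtr.
rewrite mulr_natl -[n in X in _ <= X]card_ord -sumr_const.
apply: ler_sum => i _; rewrite !mxE tnth_mktuple -expr2.
have := ft i; rewrite /= in_itv/= /node -natr1 mulrDl mul1r => /andP[h1 h2].
by rewrite lerXn2r ?nnegrE; lra.
Qed.

End grid.
End box.

Lemma seminorm_sum (R : realType) (V : lmodType R) (N : seminorm V) (I : Type)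
    (r : seq I) (F : I -> V) : N (\sum_(i <- r) F i) <= \sum_(i <- r) N (F i).
Proof.
elim/big_ind2: _ => [|x a y b xa yb|//]; first by rewrite seminorm0.
exact: le_trans (seminormD _ _ _) (lerD xa yb).
Qed.

(** * Fields of Dirac chains with bounded Lipschitz coefficients *)

Section dirac_field.
Variables (R : realType) (n k : nat).
Local Notation E := ('rV[R]_n).
Implicit Types (X : E -> dirac_chain R n k).

(** Translate (p; c a) to (q; c a), then change the coefficient at q. *)
Lemma B1_norm_moved_dirac (p q : E) (c c' : R) (a : kvector R n k) :
  B1_norm (dirac_elem p (c *: a) - dirac_elem q (c' *: a)) <=
  (`|c| * enorm (p - q) + `|c - c'|) * mass a.
Proof.
have -> : dirac_elem p (c *: a) - dirac_elem q (c' *: a) =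
    dirac_diff (p - q) q (c *: a) + dirac_elem q ((c - c') *: a).
  rewrite /dirac_diff [q + _]addrC subrK scalerBl linearB/=.
  by rewrite addrA addrNK.
apply: le_trans (seminormD (B1_seminorm R n k) _ _) _.
rewrite mulrDl -mulrA; apply: lerD.
  by apply: le_trans (B1_norm_dirac_diff _ _ _) _; rewrite massE seminormZ mulrCA.
by apply: le_trans (B1_norm_dirac _ _) _; rewrite massE seminormZ.
Qed.

Lemma B01_field_lipschitz X : is_B01_field X ->
  exists L, 0 <= L /\ forall p q, B1_norm (X p - X q) <= L * enorm (p - q).
Proof.
move=> [m [a [f [_ bl XE]]]].
have /choice[M HM] : forall i, exists M, forall p, `|f i p| <= M.
  by move=> i; case: (bl i).
have /choice[L HL] : forall i, exists L, forall p q,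
    `|f i p - f i q| <= L * enorm (p - q).
  by move=> i; case: (bl i).
exists (\sum_i (`|M i| + `|L i|) * mass (tnth a i)); split.
  by apply: sumr_ge0 => i _; rewrite mulr_ge0 ?addr_ge0// mass_ge0.
move=> p q; rewrite !XE -sumrB mulr_suml.
apply: le_trans (seminorm_sum (B1_seminorm R n k) _ _) _; apply: ler_sum => i _.
apply: le_trans (B1_norm_moved_dirac _ _ _ _ _) _.
rewrite mulrAC ler_wpM2r ?mass_ge0// mulrDl lerD//.
  by rewrite ler_wpM2r ?enorm_ge0// (le_trans (HM i p))// ler_norm.
by rewrite (le_trans (HL i p q))// ler_wpM2r ?enorm_ge0// ler_norm.
Qed.

Lemma compactly_supported_cube X : compactly_supported X ->
  exists2 K, 0 < K & forall t, ~ cube K t -> X (row_of_tuple t) = 0.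
Proof.
move=> /compact_bounded[M [_ HM]].
(* The support has sup norm at most |M| + 1, and the cube is open on the right. *)
pose K : R := `|M| + 2; exists K; first by rewrite /K ltr_wpDl.
move=> t; apply: contra_notP => /eqP Xt i.
have MK : M < `|M| + 1 by rewrite (le_lt_trans (ler_norm M))// ltrDl.
have Xc : closure [set p | X p != 0] (row_of_tuple t) by exact: subset_closure.
have /= ptM := HM _ MK _ Xc.
have : `|tnth t i| <= `|row_of_tuple t|.
  rewrite [leRHS]/Num.norm/= mx_normrE; apply/bigmax_geP; right => /=.
  by exists (ord0, i); rewrite //= mxE.
move=> /le_trans/(_ ptM); rewrite ler_norml in_itv/= => /andP[h1 h2].
by rewrite /K; lra.
Qed.

(** Bounded Lipschitz forms separate the points of the completion: a continuous
    functional phi on it restricts to such a form w on Dirac chains, and the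
    integral of w over J is phi J by density. *)
Lemma chain_integral_inj (J1 J2 : Bhat R n k) :
  (forall w : kform R n k, B1_form w -> chain_integral J1 w = chain_integral J2 w) ->
  J1 = J2.
Proof.
move=> H.
pose N := @Seminorm R (Bhat R n k) (fun x => `|x|) (@ler_normD _ _) (@normrZ _ _).
have [phi [phiN phiJ]] := norming_functional N (J1 - J2).
pose w : kform R n k := phi \o @to_Bhat R n k.
have wB A : `|w A| <= B1_norm A.
  by apply: le_trans (phiN _) _; rewrite /= norm_to_completion.
have wf : B1_form w.
  split.
    exists 1 => _ [p [a [a1 ->]]]; rewrite -a1.
    exact: le_trans (wB _) (B1_norm_dirac _ _).
  exists 1 => _ [u [p [a [a1 ->]]]]; rewrite -a1.
  exact: le_trans (wB _) (B1_norm_dirac_diff _ _ _).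
have wJ J : chain_integral J w = phi J.
  have [A AJ] := to_completion_dense J.
  have c1 := cvg_chain_integral wf AJ.
  have c2 : w (A i) @[i --> \oo] --> phi J.
    apply/cvgrPdist_le => e e0; have /cvgrPdist_le/(_ _ e0) := AJ.
    apply: filterS => i; rewrite /w/= -linearB; exact: le_trans (phiN _).
  by rewrite -(cvg_lim _ c1)// -(cvg_lim _ c2).
have := H w wf; rewrite !wJ => E.
apply/eqP; rewrite -subr_eq0 -normr_eq0.
by have := phiJ; rewrite linearB/= E subrr => <-.
Qed.

(** The Riemann sums of X over ever finer grids of a cube outside of which X
    vanishes converge to the chain J. *)
Lemma B01_field_represented X : is_B01_field X -> compactly_supported X ->
  exists J : Bhat R n k, represents J X.
Proof.
move=> /B01_field_lipschitz[L [L0 XL]] /compactly_supported_cube[K K0 X0].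
pose mu := lebesgue_tuple R n; pose D := @cube R n K.
have mD : measurable D by exact: measurable_cube.
have finD : (mu D < +oo)%E by exact: lebesgue_cube_fin.
pose F (t : n.-tuple (measurableTypeR R)) := X (row_of_tuple t).
pose P m : tagged_partition D := grid n m K0.
pose e m := L * (Num.sqrt n%:R * (2 * K / m.+1%:R)).
have e0 : e @ \oo --> (0 : R).
  rewrite -(mulr0 L) -(mulr0 (Num.sqrt n%:R)) -(mulr0 (2 * K)).
  apply: cvgM; first exact: cvg_cst.
  apply: cvgM; first exact: cvg_cst.
  apply: cvgM; first exact: cvg_cst.
  exact: cvg_harmonic.
have Fe m i t : cell (P m) i t ->
    B1_seminorm R n k (F t - F (sample (P m) i)) <= e m.
  move=> /grid_dist tP; apply: le_trans (XL _ _) _.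
  by rewrite ler_wpM2l.
pose A m := riemann_sum mu (P m) F.
have Ac : A \in @cauchy_pred R _ (B1_seminorm R n k).
  have Ac := riemann_sum_cauchy mD finD e0 Fe; exact/asboolP.
have [J AJ] : exists J : Bhat R n k, to_Bhat (A i) @[i --> \oo] --> J.
  by eexists; exact: (@to_completion_cvg R _ (B1_seminorm R n k) (CauchySequence Ac)).
exists J => w wf.
have [C wC] := B1_form_bounded wf.
have wC' B : `|w B| <= `|C| * B1_seminorm R n k B.
  apply: le_trans (wC B) _.
  by rewrite ler_wpM2r ?ler_norm// (seminorm_ge0 (B1_seminorm R n k)).
have c1 := cvg_chain_integral wf AJ.
have c2 := riemann_sum_cvg mD finD e0 Fe (normr_ge0 C) wC'.
have -> : \int[mu]_t w (X (row_of_tuple t)) = \int[mu]_(t in D) w (F t).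
  rewrite [RHS]Rintegral_mkcond; apply: eq_Rintegral => t _.
  rewrite patchE; case: ifPn => // /negP tD.
  by rewrite X0 ?linear0// => Dt; apply: tD; rewrite inE.
by rewrite -(cvg_lim _ c1)// -(cvg_lim _ c2).
Qed.

End dirac_field.

Theorem theorem4p2p1 (R : realType) (n k : nat)
    (X : 'rV[R]_n -> dirac_chain R n k)
    (X_B01 : is_B01_field X) (X_supp : compactly_supported X) :
  exists! J : Bhat R n k, represents J X.
Proof.
have [J JX] := B01_field_represented X_B01 X_supp.
exists J; split => // J' J'X; apply: chain_integral_inj => w wf.
by rewrite JX// J'X.
Qed.
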